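(* Let $\mathcal{H}$ be a Hilbert space of finite dimension $d$ with fixed computational basis $\{|j\rangle\}_{j=1}^d$, and let $|f_1\rangle=\frac{1}{\sqrt d}\sum_{j=1}^d|j\rangle$. For any density matrix $\rho$ on $\mathcal{H}$ and any $\alpha\in[\frac12,1)$, $$\mathcal{T}_{\mathrm{F}}(\rho)\leqslant(1-\alpha)\,\mathcal{T}^{\mathrm{R}}_{\alpha}(\rho).$$
   Context: A density matrix is a positive semidefinite operator of trace one. The fidelity-based texture measure is $\mathcal{T}_{\mathrm{F}}(\rho)=1-\langle f_1|\rho|f_1\rangle$. The texture measure based on the sandwiched Rényi relative entropy is, for $\alpha\in[\frac12,1)$, $\mathcal{T}^{\mathrm{R}}_{\alpha}(\rho)=\frac{1}{1-\alpha}\Big[1-\big(\langle f_1|\rho^{\frac{1-\alpha}{\alpha}}|f_1\rangle\big)^{\frac{\alpha}{1-\alpha}}\Big]$, with powers of $\rho$ defined by functional calculus. *)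

(* Defs.v *)
(* Complex numbers are R[i] for R : realType. *)
From mathcomp Require Import all_boot all_order all_algebra.
From mathcomp Require Import spectral sesquilinear.
From mathcomp Require Import complex.
From mathcomp Require Import reals exp.

Set Implicit Arguments.
Unset Strict Implicit.
Unset Printing Implicit Defensive.

Import Order.TTheory GRing.Theory Num.Theory.
Local Open Scope ring_scope.
Local Open Scope complex_scope.
Local Open Scope sesquilinear_scope.

(* H is C^d with C = R[i]; kets are column vectors, operators are matrices
   in the computational basis. *)

Section Defs.
Variables (R : realType) (d : nat).
Local Notation C := R[i].
Implicit Types (A rho : 'M[C]_d) (u v : 'cV[C]_d) (alpha : R).

Definition ket (j : 'I_d) : 'cV[C]_d := delta_mx j 0.

(* <u|A|v>, antilinear in u *)
Definition braket u A v : C := (u ^t* *m A *m v) 0 0.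

(* The order of R[i] makes 0 <= z mean that z is real and nonnegative. *)
Definition psd A : Prop :=
  A \is hermsymmx /\ forall v, 0 <= braket v A v.

Definition density_matrix rho : Prop := psd rho /\ \tr rho = 1.

Definition f1 : 'cV[C]_d :=
  ((Num.sqrt d%:R : R)^-1)%:C *: \sum_(j < d) ket j.

(* Functional calculus f(A) of a Hermitian A, whose eigenvalues are real:
   spectralmx A is a unitary P with A = P^-1 diag(spectral_diag A) P. The
   result does not depend on the diagonalization, see mxfun_unitary. *)
Definition mxfun (f : R -> R) A : 'M[C]_d :=
  invmx (spectralmx A)
  *m diag_mx (map_mx (fun z => (f (complex.Re z))%:C) (spectral_diag A))
  *m spectralmx A.

(* The exponents used below are positive, and 0 `^ s = 0 for s != 0. *)
Definition mxpowR A (s : R) : 'M[C]_d := mxfun (fun x => x `^ s) A.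

(* Both brackets are real for Hermitian rho; Re only changes their type. *)
Definition texture_F rho : R := 1 - complex.Re (braket f1 rho f1).

Definition texture_R alpha rho : R :=
  (1 - alpha)^-1 *
  (1 - (complex.Re (braket f1 (mxpowR rho ((1 - alpha) / alpha)) f1))
         `^ (alpha / (1 - alpha))).

Lemma mxfun_unitary (f : R -> R) (U : 'M[C]_d) (l : 'rV[R]_d) :
  U \is unitarymx ->
  mxfun f (invmx U *m diag_mx (map_mx (real_complex R) l) *m U) =
  invmx U *m diag_mx (map_mx (fun x => (f x)%:C) l) *m U.
Proof.
move=> Uu; have Uunit := unitarymx_unit Uu.
set D := diag_mx _; set A := invmx U *m D *m U.
have Anormal : A \is normalmx.
  apply/orthomx_spectral_subproof; exists (U, map_mx (real_complex R) l).
    by [].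
  by apply/eqP.
have /orthomx_spectralP := Anormal; rewrite /mxfun.
set P := spectralmx A; set s := spectral_diag A => eqA.
have Punit : P \in unitmx by exact: spectral_unit.
have eqW : diag_mx s *m (P *m invmx U) = P *m invmx U *m D.
  have : P *m A *m invmx U = P *m A *m invmx U by [].
  rewrite [in LHS]eqA /A !mulmxA mulmxV // mul1mx => ->.
  by rewrite -[RHS]mulmx1 -(mulmxV Uunit) !mulmxA.
have key : diag_mx (map_mx (fun z => (f (complex.Re z))%:C) s) *m (P *m invmx U) =
    P *m invmx U *m diag_mx (map_mx (fun x => (f x)%:C) l).
  move: (P *m invmx U) eqW => W eqW; apply/matrixP => i j.
  have /matrixP/(_ i j) := eqW.
  rewrite !mul_diag_mx !mul_mx_diag !mxE.
  have [->|W0] := eqVneq (W i j) 0; first by rewrite !mulr0 !mul0r.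
  by rewrite mulrC => /(mulfI W0) ->; rewrite mulrC.
rewrite -[LHS](mulmxKV Uunit) -(mulmxA (invmx P)) -(mulmxA (invmx P)).
by rewrite -(mulmxA _ P) key !mulmxA mulVmx // mul1mx.
Qed.
End Defs.

(* Main.v *)
Require Import Defs.
From mathcomp Require Import all_boot all_order all_algebra.
From mathcomp Require Import complex reals.
From mathcomp Require Import spectral sesquilinear exp.
From mathcomp Require Import ring lra.

Set Implicit Arguments.
Unset Strict Implicit.
Unset Printing Implicit Defensive.

Import Order.TTheory GRing.Theory Num.Theory.
Local Open Scope ring_scope.
Local Open Scope complex_scope.
Local Open Scope sesquilinear_scope.

(** Put [s := (1 - alpha) / alpha], which lies in ]0, 1]. In an eigenbasis of
    [rho] the numbers [|<e_i|f1>|^2] are a probability distribution on the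
    spectrum of [rho], so concavity of [x |-> x `^ s] gives
    [<f1|rho^s|f1> <= <f1|rho|f1> `^ s]; raise both sides to the power [1/s]. *)

(** Young's inequality for the product of [x^s] and [1] with conjugate exponents [1/s] and
    [1/(1-s)]; the second requires [s < 1], so [s = 1] is treated apart. *)
Lemma powR_le_tangent1 (R : realType) (s x : R) :
  0 < s <= 1 -> 0 <= x -> x `^ s <= 1 - s + s * x.
Proof.
move=> /andP[s0 s1] x0; have [->|sN1] := eqVneq s 1.
  by rewrite powRr1 // subrr add0r mul1r.
have s1' : 0 < 1 - s by rewrite subr_gt0 lt_neqAle sN1.
have := @conjugate_powR R (x `^ s) 1 s^-1 (1 - s)^-1.
rewrite !invrK !powR1 -powRrM divff ?gt_eqF // powRr1 // mulr1 mul1r.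
rewrite powR_ge0 ler01 !invr_gt0 s0 s1' subrKC.
by rewrite mulrC addrC; apply.
Qed.

Lemma powR_root_le (R : realType) (s x y : R) :
  0 < s -> 0 <= x -> 0 <= y -> x <= y `^ s -> x `^ s^-1 <= y.
Proof.
move=> s0 x0 y0 xy; rewrite -[leRHS](powRr1 y0) -(divff (lt0r_neq0 s0)) powRrM.
by apply: ge0_ler_powR; rewrite ?nnegrE ?powR_ge0 ?invr_ge0 // ltW.
Qed.

Lemma powR_jensen (R : realType) (n : nat) (w x : 'I_n -> R) (s : R) :
  0 < s <= 1 -> (forall i, 0 <= w i) -> \sum_i w i = 1 ->
  (forall i, 0 <= x i) ->
  \sum_i w i * x i `^ s <= (\sum_i w i * x i) `^ s.
Proof.
move=> s01 w0 w1 x0; have [s0 s1] := andP s01.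
set m := \sum_i w i * x i.
have wx0 i : 0 <= w i * x i by rewrite mulr_ge0.
have m0 : 0 <= m by apply: sumr_ge0 => i _.
(* The tangent at [m] is used only for [m != 0]. A zero mean kills every [w i * x i], and zero to
   the power [s] is zero since [s > 0]. *)
have [mE|mN0] := eqVneq m 0.
  rewrite big1 ?powR_ge0 // => i _.
  have /eqP := psumr_eq0P (fun i _ => wx0 i) mE (i:=i) isT.
  rewrite mulf_eq0 => /orP[]/eqP ->; first by rewrite mul0r.
  by rewrite powR0 ?mulr0 // gt_eqF.
have mgt0 : 0 < m by rewrite lt_def mN0.
(* The graph of [x |-> x `^ s] lies below its tangent at the mean [m]. *)
have le_i i : w i * x i `^ s <=
    m `^ s * (w i * (1 - s) + s * m^-1 * (w i * x i)).
  (* Homogeneity: with [x i = (x i / m) * m], the tangent at [m] becomes the tangent at 1. *)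
  rewrite -{1}[x i](mulrVK (x := m)) ?unitfE //.
  rewrite powRM ?divr_ge0 //.
  have := powR_le_tangent1 s01 (divr_ge0 (x0 i) m0).
  move=> /(ler_wpM2l (mulr_ge0 (powR_ge0 m s) (w0 i))) h.
  by rewrite (le_trans _ (le_trans h _)) // le_eqVlt; apply/predU1P; left; ring.
apply: le_trans (ler_sum _ (fun i _ => le_i i)) _.
rewrite -mulr_sumr big_split /= -mulr_suml -mulr_sumr w1 -/m mul1r.
by rewrite -mulrA mulVf // mulr1 subrK mulr1.
Qed.

Lemma complex_Re_ge0 (R : realType) (z : R[i]) : 0 <= z -> 0 <= complex.Re z.
Proof. by rewrite lecE => /andP[]. Qed.

Section Spectral.
Variables (R : realType) (d : nat).
Local Notation C := R[i].
Implicit Types (A : 'M[C]_d) (u : 'cV[C]_d) (f : R -> R).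

(** For normal [A], row [i] of [spectralmx A] is the bra of the eigenvector [e_i], so this is
    [|<e_i|u>|^2]. *)
Definition spectral_weight A u (i : 'I_d) : R :=
  complex.Re (`|(spectralmx A *m u) i 0| ^+ 2).

Lemma spectral_weight_ge0 A u i : 0 <= spectral_weight A u i.
Proof. by apply: complex_Re_ge0; rewrite exprn_ge0. Qed.

Lemma braket_mxfun f A u :
  complex.Re (braket u (mxfun f A) u) =
  \sum_i spectral_weight A u i * f (complex.Re (spectral_diag A 0 i)).
Proof.
rewrite /braket /mxfun /spectral_weight invmx_unitary ?spectral_unitarymx //.
set P := spectralmx A.
rewrite !mulmxA -map_mxM -trmx_mul -2!mulmxA (mulmxA _ P) mul_diag_mx mxE.
rewrite (raddf_sum (@complex.Re R : {additive (Rcomplex R) -> R})).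
apply: eq_bigr => i _; rewrite !mxE.
under [X in _ * X]eq_bigr do rewrite !mxE -mulrA.
rewrite -mulr_sumr; set z := \sum_j _.
(* Here [z] is coordinate [i] of [P *m u]; it meets its own conjugate, coming from the bra. *)
rewrite mulrCA (mulrC _ z) -normCK.
by case: (`|z| ^+ 2) => a b /=; rewrite mul0r subr0 mulrC.
Qed.

(** The eigenvalues of a Hermitian matrix are real, so the real part taken in [mxfun] loses
    nothing. *)
Lemma mxfun_id A : A \is hermsymmx -> mxfun id A = A.
Proof.
move=> Aherm; have /orthomx_spectralP AE := hermitian_normalmx Aherm.
rewrite /mxfun (_ : map_mx _ _ = spectral_diag A) -?AE //.
apply/rowP => i; rewrite mxE RRe_real //.
by have /mxOverP/(_ 0 i) := hermitian_spectral_diag_real Aherm.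
Qed.

Lemma mxfun1 A : mxfun (fun=> 1) A = 1%:M.
Proof.
rewrite /mxfun (_ : diag_mx _ = 1%:M) ?mulmx1 ?mulVmx ?spectral_unit //.
by apply/matrixP => i j; rewrite !mxE.
Qed.

Lemma psd_spectral_diag_ge0 A i : psd A -> 0 <= complex.Re (spectral_diag A 0 i).
Proof.
(* The test vector is the [i]-th eigenvector, at which the quadratic form equals the [i]-th
   eigenvalue. *)
case=> Aherm /(_ ((spectralmx A)^t* *m ket R i)).
have /orthomx_spectralP AE := hermitian_normalmx Aherm.
rewrite /braket [X in _ *m X *m _]AE invmx_unitary ?spectral_unitarymx //.
have /unitarymxP := spectral_unitarymx A.
set P := spectralmx A => PP.
rewrite trmx_mul map_mxM trmxCK !mulmxA.
rewrite -(mulmxA _ P) PP mulmx1 -(mulmxA _ P) PP mulmx1.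
rewrite -mulmxA mul_diag_mx mxE (bigD1 i) //= big1 => [|j jNi].
  rewrite !mxE !eqxx rmorph1 mul1r mulr1 addr0; exact: complex_Re_ge0.
by rewrite !mxE (negbTE jNi) rmorph0 mul0r.
Qed.

Lemma braket_mxpowR A u s : 0 < s <= 1 -> psd A -> braket u 1%:M u = 1 ->
  complex.Re (braket u (mxpowR A s) u) <= complex.Re (braket u A u) `^ s.
Proof.
move=> s01 Apsd u1; rewrite /mxpowR braket_mxfun.
have := braket_mxfun id A u; rewrite (mxfun_id (proj1 Apsd)) => ->.
apply: powR_jensen => // [i||i].
- exact: spectral_weight_ge0.
(* The constant function 1 turns the total weight into [<u|u> = 1]. *)
- have := braket_mxfun (fun=> 1) A u; rewrite mxfun1 u1 /= => ->.
  by under [RHS]eq_bigr do rewrite mulr1.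
- exact: psd_spectral_diag_ge0.
Qed.

End Spectral.

Lemma f1_unit (R : realType) (d : nat) : (0 < d)%N ->
  braket (f1 R d) 1%:M (f1 R d) = 1.
Proof.
move=> d0; rewrite /braket mulmx1 mxE.
have f1E i : f1 R d i 0 = ((Num.sqrt d%:R)^-1)%:C.
  rewrite /f1 mxE summxE (bigD1 i) //= big1 => [|j jNi].
    by rewrite /ket mxE !eqxx addr0 mulr1.
  by rewrite /ket mxE eq_sym (negbTE jNi).
have f1J i : (f1 R d)^t* 0 i = ((Num.sqrt d%:R)^-1)%:C.
  by rewrite 2!mxE f1E; exact: conjc_real.
under eq_bigr do rewrite f1J f1E -rmorphM.
rewrite sumr_const card_ord -rmorphMn -invfM -expr2 sqr_sqrtr ?ler0n //.
by rewrite -mulr_natr mulVf ?rmorph1 // pnatr_eq0 -lt0n.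
Qed.

Theorem proposition7 (R : realType) (d : nat) (rho : 'M[R[i]]_d) (alpha : R)
  (hrho : density_matrix rho) (halpha : 2^-1 <= alpha) (halpha1 : alpha < 1) :
  texture_F rho <= (1 - alpha) * texture_R alpha rho.
Proof.
have [rho_psd rho_tr] := hrho.
(* In dimension 0 the trace would be 0 instead of 1. *)
have d0 : (0 < d)%N.
  rewrite lt0n; apply/negP => /eqP d0; subst d.
  by move/eqP: rho_tr; rewrite /mxtrace big_ord0 eq_sym oner_eq0.
have a0 : 0 < alpha by lra.
have b0 : 0 < 1 - alpha by lra.
set s := (1 - alpha) / alpha.
(* The bound [s <= 1] amounts to [alpha >= 1/2]. *)
have s01 : 0 < s <= 1 by rewrite divr_gt0 //= ler_pdivrMr //; lra.
rewrite /texture_F /texture_R mulrA divff ?gt_eqF // mul1r lerD2l lerN2.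
have sV : alpha / (1 - alpha) = s^-1 by rewrite invf_div.
have F0 : 0 <= complex.Re (braket (f1 R d) rho (f1 R d)).
  by apply: complex_Re_ge0; apply: (proj2 rho_psd).
(* Raising to the power [1/s] is monotone on nonnegative reals only, hence this sign check. *)
have p0 : 0 <= complex.Re (braket (f1 R d) (mxpowR rho s) (f1 R d)).
  rewrite braket_mxfun; apply: sumr_ge0 => i _.
  by rewrite mulr_ge0 ?powR_ge0 ?spectral_weight_ge0.
rewrite sV; apply: powR_root_le => //; first by case/andP: s01.
exact: braket_mxpowR s01 rho_psd (f1_unit R d0).
Qed.
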